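(* For $x\in[0,1]$ let $\mathbf{p}=(x,1-x)$ be a probability distribution on two colors. Then $$\max_{x\in[0,1]} D\big((x,1-x)\big)=\frac{1}{\sqrt{135+78\sqrt{3}}},$$ and this maximum is attained at $$x_1=\frac16\left(3+\sqrt{3\left(-3+2\sqrt3\right)}\right).$$
   Context: For a probability distribution $\mathbf{p}=(p_i)_i$ on a finite or countable set of colors, define two derived distributions on colors. Method 1: $\mathbb{P}(X=i)=p_i^2/f_2$ with $f_2=\sum_i p_i^2$ (the color of a pair of independent samples from $\mathbf{p}$, conditional on the two agreeing). Method 2: $Y$ is the first color to be seen twice when sampling independently from $\mathbf{p}$, one at a time; explicitly $$\mathbb{P}(Y=i)=p_i^2\sum_{k\ge 0}(k+1)!\sum_{J:\,|J|=k,\ i\notin J}\ \prod_{j\in J}p_j ,$$ the inner sum being over sets $J$ of $k$ distinct colors not containing $i$. The discrepancy of $\mathbf{p}$ is the total variation distance between these two laws: $$D(\mathbf{p})=\frac12\sum_i\big|\mathbb{P}(X=i)-\mathbb{P}(Y=i)\big|.$$ *)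

(* Defs.v *)
From HB Require Import structures.
From mathcomp Require Import all_boot all_order all_algebra.
From mathcomp Require Import finmap.
From mathcomp Require Import all_classical all_reals all_analysis.

Set Implicit Arguments.
Unset Strict Implicit.
Unset Printing Implicit Defensive.

Import Order.TTheory GRing.Theory Num.Theory.

Local Open Scope classical_set_scope.
Local Open Scope ring_scope.

(* A distribution on a finite or countable set [T] of colors is given by its
   mass function [p : T -> R].  All the sums over colors below have nonnegative
   terms and are taken in [\bar R]; [fine] maps them back to [R]. *)

(* f_2, the probability that two independent samples agree. *)
Definition f2 (R : realType) (T : countType) (p : T -> R) : R :=
  fine (\esum_(i in [set: T]) (p i ^+ 2)%:E).

(* Law of the color of a pair of independent samples conditioned to agree. *)
Definition agreeing_pair_law (R : realType) (T : countType) (p : T -> R)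
    (i : T) : R :=
  p i ^+ 2 / f2 p.

(* Law of the first color seen twice in i.i.d. sampling: [J] is the set of the
   [k] other colors seen by then, and [(k+1)!] counts the orders in which the
   first [k+1] samples, namely those of [J] and the first [i], can occur.
   For a distribution the product in [\bar R] is at most 1; the inner series
   may diverge only if [p i = 0], and then the product is [0 * +oo = 0]. *)
Definition first_repeat_law (R : realType) (T : countType) (p : T -> R)
    (i : T) : R :=
  fine ((p i ^+ 2)%:E *
        \sum_(0 <= k <oo)
          ((k.+1)`!%:R)%:E *
          \esum_(J in [set J : {fset T} | #|` J|%fset = k /\ i \notin J])
            (\prod_(j <- J) p j)%:E)%E.

(* Total variation distance between the two laws. *)
Definition discrepancy (R : realType) (T : countType) (p : T -> R) : R :=
  2^-1 * fine (\esum_(i in [set: T])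
                 `|agreeing_pair_law p i - first_repeat_law p i|%:E).

(* The distribution (x, 1 - x) on two colors. *)
Definition two_colors (R : realType) (x : R) : bool -> R :=
  fun i => if i then x else 1 - x.

(* Main.v *)
Require Import Defs.
From HB Require Import structures.
From mathcomp Require Import all_boot all_order all_algebra.
From mathcomp Require Import finmap.
From mathcomp Require Import all_classical all_reals all_analysis.
From mathcomp Require Import ring lra.

Import Order.TTheory GRing.Theory Num.Theory.

Local Open Scope ring_scope.

(** With two colors of masses x and y = 1 - x, a set J of colors other than i
    is empty or the singleton of the other color, so the series for the law of
    the first repeated color has only the terms k = 0 and k = 1:
    P(Y = i) = p_i^2 (1 + 2 p_j), where j is the other color
    ([first_repeat_law_bool]).  In terms of the bias d = x - y = 2 x - 1 one has
    f_2 = (1 + d^2) / 2, and the differences P(X = i) - P(Y = i) for the two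
    colors are opposite to each other, so that ([discrepancy_two_colors])

      D(x, 1 - x) = |d| (1 - d^2)^2 / (4 (1 + d^2)).

    By symmetry this is to be maximized over 0 <= d <= 1.  For 0 < d < 1 the
    derivative vanishes exactly when 3 d^4 + 6 d^2 = 1, that is
    d^2 = 2 / sqrt 3 - 1; call e this critical bias.  The value there simplifies to e^3, and maximality is
    the polynomial inequality d (1 - d^2)^2 <= 4 e^3 (1 + d^2), whose two sides
    have a difference divisible by (d - e)^2 with a quotient visibly
    nonnegative on [0, 1] ([critical_bias_max]).  It remains to recognize the
    bias of x_1 as e, and the announced maximum as e^3. *)

Lemma esum_bool (R : realType) (a : bool -> \bar R) :
  (forall b, 0 <= a b)%E ->
  (\esum_(b in [set: bool]) a b = a true + a false)%E.
Proof.
move=> a0; rewrite setT_bool esum_fset//.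
rewrite fsbigU0 ?fsbig_set1//; try exact: finite_set1.
by move=> b [/= ->].
Qed.

Lemma fset_bool_notin (i : bool) (J : {fset bool}) :
  i \notin J -> J = fset0 \/ J = [fset ~~ i]%fset.
Proof.
move=> iJ; have : (J `<=` [fset ~~ i])%fset.
  apply/fsubsetP => j jJ; rewrite inE.
  by case: i j iJ jJ => -[] // /negP iJ /iJ.
by rewrite fsubset1 => /orP[] /eqP; [right | left].
Qed.

Lemma first_repeat_law_bool (R : realType) (p : bool -> R) (i : bool) :
  0 <= p (~~ i) -> first_repeat_law p i = p i ^+ 2 * (1 + 2 * p (~~ i)).
Proof.
move=> p0; rewrite /first_repeat_law.
set S := fun k => \esum_(J in [set J : {fset bool} | #|` J|%fset = k /\ i \notin J])
                    (\prod_(j <- J) p j)%:E.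
have S0 : S 0%N = 1%E.
  rewrite /S (_ : [set J | _]%classic = [set fset0]%classic).
    by rewrite esum_set1 big_seq_fset0.
  apply/seteqP; split => [J [/= /eqP]|_ -> //=].
  by rewrite cardfs_eq0 => /eqP.
have S1 : S 1%N = (p (~~ i))%:E.
  rewrite /S (_ : [set J | _]%classic = [set [fset ~~ i]%fset]%classic).
    by rewrite esum_set1 big_seq_fset1.
  apply/seteqP; split => [J [/= J1 /fset_bool_notin[JE|//]]|_ -> /=].
    by move: J1; rewrite JE cardfs0.
  by rewrite cardfs1 inE; case: (i).
have S2 k : (2 <= k)%N -> S k = 0%E.
  move=> k2; rewrite /S (_ : [set J | _]%classic = set0) ?esum_set0//.
  apply/seteqP; split => // J [/= Jk /fset_bool_notin JE].
  by move: k2; rewrite -Jk; case: JE => ->; rewrite ?cardfs0 ?cardfs1.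
have Sge0 k : (0 <= (k.+1)`!%:R%:E * S k)%E.
  apply: mule_ge0; first by rewrite lee_fin.
  case: k => [|[|k]]; first by rewrite S0.
    by rewrite S1 lee_fin.
  by rewrite S2.
rewrite -[X in (_ * X)%E]/(\sum_(0 <= k <oo) ((k.+1)`!%:R)%:E * S k)%E.
rewrite (@nneseries_split _ _ 0 2)// [X in (_ + X)%E]eseries0; last first.
  by move=> k k2 _; rewrite -/(S k) S2 // mule0.
rewrite adde0 !big_nat_recr //= big_geq // -/(S 0%N) -/(S 1%N) S0 S1.
by rewrite add0e mule1 -EFinM.
Qed.

Lemma f2_two_colors (R : realType) (x : R) :
  f2 (two_colors x) = x ^+ 2 + (1 - x) ^+ 2.
Proof. by rewrite /f2 esum_bool//= => b; rewrite lee_fin sqr_ge0. Qed.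

(** The factor 4 - (3 - d^2) (1 + d^2) that the difference of the two laws
    produces is the square (1 - d^2)^2, hence the sign of that difference is the
    sign of d. *)
Lemma discrepancy_two_colors (R : realType) (x : R) : 0 <= x <= 1 ->
  discrepancy (two_colors x) =
    `|2 * x - 1| * (1 - (2 * x - 1) ^+ 2) ^+ 2 / (4 * (1 + (2 * x - 1) ^+ 2)).
Proof.
move=> /andP[x0 x1]; rewrite /discrepancy esum_bool//=.
rewrite /agreeing_pair_law f2_two_colors !first_repeat_law_bool/=; try lra.
have den_gt0 : 0 < 4 * (1 + (2 * x - 1) ^+ 2) by nra.
set d := 2 * x - 1 in den_gt0 *.
set c := (1 - d ^+ 2) ^+ 2 / (4 * (1 + d ^+ 2)).
have c0 : 0 <= c by rewrite divr_ge0 ?sqr_ge0// ltW.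
have den_neq0 : 1 + d ^+ 2 != 0 by rewrite gt_eqF//; nra.
have f2_neq0 : x ^+ 2 + (1 - x) ^+ 2 != 0 by rewrite gt_eqF//; nra.
have -> : x ^+ 2 / (x ^+ 2 + (1 - x) ^+ 2) - x ^+ 2 * (1 + 2 * (1 - x)) = d * c.
  by rewrite /c /d; field; rewrite f2_neq0 den_neq0.
have -> : (1 - x) ^+ 2 / (x ^+ 2 + (1 - x) ^+ 2) - (1 - x) ^+ 2 * (1 + 2 * x)
          = - (d * c).
  by rewrite /c /d; field; rewrite f2_neq0 den_neq0.
by rewrite normrN normrM (ger0_norm c0) -mulrA -/c; field.
Qed.

(** Under the equation on e, the difference of the two sides has a double zero
    at d = e; the cubic quotient is concave on [0, 1], which is what writes it
    as the interpolation of its values at 0 and 1 plus a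
    nonnegative multiple of d (1 - d). *)
Lemma critical_bias_max (R : realFieldType) (e d : R) :
  0 <= e <= 1 -> 3 * e ^+ 4 + 6 * e ^+ 2 = 1 -> 0 <= d <= 1 ->
  d * (1 - d ^+ 2) ^+ 2 <= 4 * e ^+ 3 * (1 + d ^+ 2).
Proof.
move=> /andP[e0 e1] eE /andP[d0 d1].
pose q := (1 - d) * (4 * e) + d * ((1 - e) * (1 + 3 * e))
          + d * (1 - d) * (d + 1 + 2 * e).
have q0 : 0 <= q.
  by rewrite /q !addr_ge0 // !mulr_ge0 // ?subr_ge0 //; lra.
rewrite -subr_ge0.
have -> : 4 * e ^+ 3 * (1 + d ^+ 2) - d * (1 - d ^+ 2) ^+ 2
          = (d - e) ^+ 2 * q + d * (3 * e ^+ 4 + 6 * e ^+ 2 - 1).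
  by rewrite /q; ring.
by rewrite eE subrr mulr0 addr0 mulr_ge0 // sqr_ge0.
Qed.

(** The critical value of the discrepancy is e^3 because the critical equation
    also reads (1 - e^2)^2 = 4 e^2 (1 + e^2). *)
Lemma critical_bias_value (R : realFieldType) (e : R) :
  3 * e ^+ 4 + 6 * e ^+ 2 = 1 ->
  e * (1 - e ^+ 2) ^+ 2 / (4 * (1 + e ^+ 2)) = e ^+ 3.
Proof.
move=> eE; have den_neq0 : 1 + e ^+ 2 != 0 by rewrite gt_eqF//; nra.
have -> : (1 - e ^+ 2) ^+ 2
          = 4 * e ^+ 2 * (1 + e ^+ 2) + (1 - (3 * e ^+ 4 + 6 * e ^+ 2)).
  by ring.
by rewrite eE subrr addr0; field.
Qed.

Theorem mainTheorem2 (R : realType) :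
  let M : R := 1 / Num.sqrt (135 + 78 * Num.sqrt 3) in
  let x1 : R := 1 / 6 * (3 + Num.sqrt (3 * (- 3 + 2 * Num.sqrt 3))) in
  (forall x : R, 0 <= x <= 1 -> discrepancy (two_colors x) <= M) /\
  (0 <= x1 <= 1 /\ discrepancy (two_colors x1) = M).
Proof.
move=> M x1.
set s : R := Num.sqrt 3 in M x1 *.
have s0 : 0 <= s := sqrtr_ge0 _.
have s2 : s ^+ 2 = 3 by rewrite sqr_sqrtr.
have s_bounds : 3 / 2 < s < 2 by apply/andP; split; nra.
have [s_gt s_lt] := andP s_bounds.
pose e := 2 * x1 - 1.
have eS : e = Num.sqrt (3 * (- 3 + 2 * s)) / 3 by rewrite /e /x1; field.
have e2 : e ^+ 2 = (2 * s - 3) / 3.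
  by rewrite eS expr_div_n sqr_sqrtr; [field | lra].
have e_gt0 : 0 < e by rewrite eS divr_gt0 // sqrtr_gt0; lra.
have e_le1 : e <= 1 by nra.
have eE : 3 * e ^+ 4 + 6 * e ^+ 2 = 1.
  by rewrite (_ : e ^+ 4 = (e ^+ 2) ^+ 2); [rewrite e2; field: s2 | ring].
have ME : M = e ^+ 3.
  have -> : M = 1 / Num.sqrt ((e ^- 3) ^+ 2).
    rewrite /M; congr (1 / Num.sqrt _).
    (* (2 s / 3 - 1)^3 (135 + 78 s) = 1 whenever s^2 = 3 *)
    have e6 : (e ^+ 3) ^+ 2 * (135 + 78 * s) = 1.
      by rewrite (_ : (e ^+ 3) ^+ 2 = (e ^+ 2) ^+ 3); [rewrite e2; field: s2 | ring].
    apply: (mulfI (_ : (e ^+ 3) ^+ 2 != 0)); first by rewrite !expf_neq0 ?gt_eqF.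
    by rewrite e6 -exprMn divff ?expr1n // expf_neq0 ?gt_eqF.
  by rewrite sqrtr_sqr ger0_norm ?invr_ge0 ?exprn_ge0 ?(ltW e_gt0) // div1r invrK.
have x1_bounds : 0 <= x1 <= 1 by apply/andP; split; rewrite /e in e_gt0 e_le1; lra.
split=> [x /andP[x_ge0 x_le1]|].
  rewrite discrepancy_two_colors ?x_ge0 // ME ler_pdivrMr; last by nra.
  rewrite -[(2 * x - 1) ^+ 2]real_normK ?num_real //.
  rewrite [leRHS](_ : _ = 4 * e ^+ 3 * (1 + `|2 * x - 1| ^+ 2)); last by ring.
  apply: critical_bias_max => //; first by rewrite ltW.
  by rewrite normr_ge0 ler_norml; apply/andP; split; lra.
split=> //.
by rewrite discrepancy_two_colors // -/e (ger0_norm (ltW e_gt0)) critical_bias_value.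
Qed.
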